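(* Let $T=C$ (the Cesàro operator) or $T=C^*$ (the Copson operator), and let $I=[0,1]$ or $I=[0,\infty)$. Assume that $X$ and $Y$ are symmetric spaces on $I$ such that (i) the Cesàro operator $C$ is bounded on $X$ and on $Y$, if $T=C$; (ii) both operators $C$ and $C^*$ are bounded on $X$ and on $Y$, if $T=C^*$. Then $X=Y$ if and only if $TX=TY$, where equality of spaces means that they have the same elements and equivalent norms.
   Context: $m$ is Lebesgue measure, $L^0(I)$ the space of (a.e. classes of) real-valued Lebesgue measurable functions on $I$. A Banach function space $X$ on $I$ is a Banach space that is a linear subspace of $L^0(I)$ with the ideal property: $|f|\le|g|$ a.e., $f\in L^0(I)$, $g\in X$ imply $f\in X$ and $\|f\|_X\le\|g\|_X$; by convention $X$ also contains a function positive a.e. on $I$. A symmetric space is a Banach function space $X$ such that if $f,g\in L^0(I)$ are equimeasurable ($m\{|f|>s\}=m\{|g|>s\}$ for all $s>0$) and $f\in X$, then $g\in X$ and $\|f\|_X=\|g\|_X$. Cesàro operator: $Cf(x)=\frac1x\int_0^x f(t)\,dt$ for $0<x\in I$. Copson operator: $C^*f(x)=\int_{I\cap[x,\infty)}\frac{f(t)}{t}\,dt$ for $x\in I$. $TX=\{f\in L^0(I): T|f|\in X\}$ with norm $\|f\|_{TX}=\|T|f|\|_X$. *)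

(* Defs.v *)
From HB Require Import structures.
From mathcomp Require Import all_boot all_order all_algebra.
From mathcomp Require Import all_classical all_reals all_analysis.

Set Implicit Arguments.
Unset Strict Implicit.
Unset Printing Implicit Defensive.

Import Order.TTheory GRing.Theory Num.Theory.
Import numFieldNormedType.Exports.

Local Open Scope classical_set_scope.
Local Open Scope ring_scope.

(* The real line with the sigma-algebra of Lebesgue measurable sets; the
   canonical structure on R itself is the Borel one. *)
Notation lebesgueType R :=
  (caratheodory_type (((@wlength R idfun)^*)%mu)).

Notation leb := (@completed_lebesgue_measure _).

(* Elements of L^0(I) are represented by functions R -> R, whose values outside
   I are irrelevant; a.e. equality is dealt with by the ideal property below. *)
Definition L0 (R : realType) (I : set R) : set (R -> R) :=
  [set f | measurable_fun (I : set (lebesgueType R)) (f : lebesgueType R -> R)].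

Definition ae_on (R : realType) (I : set R) (P : R -> Prop) : Prop :=
  \forall x \ae @completed_lebesgue_measure R, I x -> P x.

Record fspace (R : realType) := FSpace {
  fs_mem : set (R -> R);
  fs_norm : (R -> R) -> R
}.

Record banach_function_space (R : realType) (I : set R) (X : fspace R) : Prop :=
  BanachFunctionSpace {
  bfs_sub : fs_mem X `<=` L0 I;
  bfs_add : forall f g, fs_mem X f -> fs_mem X g -> fs_mem X (f \+ g);
  bfs_scale : forall (a : R) f, fs_mem X f -> fs_mem X (fun x => a * f x);
  bfs_norm_ge0 : forall f, fs_mem X f -> 0 <= fs_norm X f;
  bfs_norm_eq0 : forall f, fs_mem X f -> fs_norm X f = 0 ->
    ae_on I (fun x => f x = 0);
  bfs_normZ : forall (a : R) f, fs_mem X f ->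
    fs_norm X (fun x => a * f x) = `|a| * fs_norm X f;
  bfs_normD : forall f g, fs_mem X f -> fs_mem X g ->
    fs_norm X (f \+ g) <= fs_norm X f + fs_norm X g;
  bfs_complete : forall u : nat -> R -> R, (forall n, fs_mem X (u n)) ->
    (forall e : R, 0 < e -> exists N : nat, forall n p : nat,
       (N <= n)%N -> (N <= p)%N -> fs_norm X (u n \- u p) < e) ->
    exists2 f, fs_mem X f & fs_norm X (u n \- f) @[n --> \oo] --> (0 : R);
  bfs_ideal : forall f g, L0 I f -> fs_mem X g ->
    ae_on I (fun x => `|f x| <= `|g x|) ->
    fs_mem X f /\ fs_norm X f <= fs_norm X g;
  bfs_pos : exists2 f, fs_mem X f & ae_on I (fun x => 0 < f x)
}.

Definition equimeasurable (R : realType) (I : set R) (f g : R -> R) : Prop :=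
  forall s : R, 0 < s ->
    leb [set x | I x /\ s < `|f x|] = leb [set x | I x /\ s < `|g x|].

Record symmetric_space (R : realType) (I : set R) (X : fspace R) : Prop :=
  SymmetricSpace {
  sym_bfs : banach_function_space I X;
  sym_equi : forall f g, L0 I f -> L0 I g -> equimeasurable I f g ->
    fs_mem X f -> fs_mem X g /\ fs_norm X f = fs_norm X g
}.

Local Open Scope ereal_scope.

Definition cesaro_op (R : realType) (f : R -> R) (x : R) : \bar R :=
  (x^-1)%:E * \int[leb]_(t in `[0%R, x]) (f t)%:E.

Definition copson_op (R : realType) (I : set R) (f : R -> R) (x : R) : \bar R :=
  \int[leb]_(t in I `&` `[x, +oo[) (f t / t)%:E.

Local Close Scope ereal_scope.

(* Membership in X of an extended real function. As oo - oo is infinite in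
   \bar R, an integral of a measurable function is finite exactly when the
   function is integrable: finiteness a.e. of [cesaro_op f] or [copson_op I f] says
   that the integrals defining it converge absolutely for a.e. x in I. *)
Definition emem (R : realType) (I : set R) (X : fspace R) (g : R -> \bar R) :
    Prop :=
  ae_on I (fun x => g x \is a fin_num) /\ fs_mem X (fine \o g).

Definition bounded_on (R : realType) (I : set R)
    (T : (R -> R) -> R -> \bar R) (X : fspace R) : Prop :=
  exists K : R, forall f, fs_mem X f ->
    emem I X (T f) /\ fs_norm X (fine \o T f) <= K * fs_norm X f.

Definition op_space (R : realType) (I : set R) (T : (R -> R) -> R -> \bar R)
    (X : fspace R) : fspace R :=
  FSpace [set f | L0 I f /\ emem I X (T (fun x => `|f x|))]
         (fun f => fs_norm X (fine \o T (fun x => `|f x|))).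

Definition space_eq (R : realType) (X Y : fspace R) : Prop :=
  fs_mem X = fs_mem Y /\
  exists a b : R, [/\ 0 < a, 0 < b &
    forall f, fs_mem X f ->
      a * fs_norm X f <= fs_norm Y f /\ fs_norm Y f <= b * fs_norm X f].

(* Main.v *)
Require Import Defs.
From HB Require Import structures.
From mathcomp Require Import all_boot all_order all_algebra.
From mathcomp Require Import all_classical all_reals all_analysis.
From mathcomp Require Import ring lra measurable_realfun.
Import Order.TTheory GRing.Theory Num.Theory.
Import numFieldNormedType.Exports.
Local Open Scope classical_set_scope.
Local Open Scope ring_scope.

(** The equality [X = Y] only involves nonincreasing functions, because a
    symmetric space contains [f] exactly when it contains the decreasing
    rearrangement [f^*], with the same norm. It is therefore enough to see that
    a nonincreasing [g >= 0] lies in [X] if and only if it lies in [TX], with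
    comparable norms ([X] stands for either space).

    If [g] is in [X], then [Tg] is in [X] since [T] is bounded on [X]. For the
    converse, [T] must be bounded below on nonincreasing functions.
    - For [T = C], the mean of [g] over [[0, x]] is at least [g x], hence
      [g <= C g] ([cesaro_ge_nonincreasing]) and the ideal property applies.
    - For [T = C^*], the pointwise bound fails, as [C^* g (x)] only sees [g]
      beyond [x]; but [C^* g >= g x / 2] on [(0, x / 2]], so that averaging
      gives [g <= 4 C (C^* g)] ([le_cesaro_copson]), and [C] is bounded on [X].
    If [TX = TY] then, for [f] in [X], membership passes along
    [f^* in X], [f^* in TX = TY], [f^* in Y], [f in Y]
    ([embedding_of_op_space]).

    The rearrangement has to be finite-valued, i.e. the distribution function
    of every [f] in [X] must tend to [0]. This follows from symmetry alone
    ([symmetric_distr_vanishes]): if every set [{|f| > n}] had measure more than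
    [t > 0], then [n * \1_]0, t[] would lie below a rearrangement of the function
    [n * \1_{|f| > n} <= |f|], so its norm would stay bounded in [n], forcing
    [\1_]0, t[] to vanish. *)

Set Implicit Arguments.
Unset Strict Implicit.
Unset Printing Implicit Defensive.

(** * Lebesgue measurability and almost everywhere statements *)

Lemma measurable_interval (R : realType) (i : interval R) :
  measurable ([set` i] : set (lebesgueType R)).
Proof. by apply: sub_caratheodory; exact: measurable_itv. Qed.

Lemma leb_itv (R : realType) (i : interval R) :
  leb ([set` i] : set R) =
  (if (i.1 < i.2)%E then ((i.2 : \bar R) - i.1)%E else 0%E).
Proof. exact: lebesgue_measure_itv. Qed.

Lemma measurable_superlevelP (R : realType) (D : set R) (f : R -> R) :
  measurable (D : set (lebesgueType R)) ->
  (forall r : R, measurable ([set x | D x /\ r < f x] : set (lebesgueType R))) ->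
  measurable_fun (D : set (lebesgueType R)) (f : lebesgueType R -> R).
Proof.
move=> mD mf; apply: (measurability (@RGenOInfty.G R)).
  exact: RGenOInfty.measurableE.
move=> _ /= [_ [r ->] <-].
rewrite (_ : _ `&` _ = [set x | D x /\ r < f x]); first exact: mf.
by apply/seteqP; split => x /=; rewrite in_itv/= andbT.
Qed.

Lemma ae_on_sub (R : realType) (I D : set R) (P Q : R -> Prop) :
  D `<=` I -> ae_on I P ->
  (forall x, D x -> P x -> Q x) -> ae_on D Q.
Proof.
move=> DI [N [mN N0 PN]] PQ; exists N; split => // x /= nQ; apply: PN => /= Px.
by apply: nQ => Dx; apply: PQ => //; apply: Px; exact: DI.
Qed.

Lemma ae_on_and (R : realType) (I : set R) (P Q : R -> Prop) :
  ae_on I P -> ae_on I Q ->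
  ae_on I (fun x => P x /\ Q x).
Proof.
rewrite /ae_on => aeP aeQ.
have FF : Filter (nbhs (almost_everywhere (@completed_lebesgue_measure R))).
  exact: ae_filter_ringOfSetsType.
by apply: (filterS2 _ _ aeP aeQ) => x Px Qx Ix; split; [exact: Px|exact: Qx].
Qed.

(** * Distribution function and decreasing rearrangement *)

Definition distr (R : realType) (I : set R) (f : R -> R) (s : R) : \bar R :=
  leb [set x | I x /\ s < `|f x|].

(** Only [t > 0] carries information: at [t = 0] the supremum is infinite when
    [f] is unbounded. With the value [0] for [t <= 0], the superlevel sets at
    levels [s >= 0] are intervals with left end [0]. *)
Definition rearrangement (R : realType) (I : set R) (f : R -> R) (t : R) : R :=
  if 0 < t then sup [set s | 0 <= s /\ (t%:E < distr I f s)%E] else 0.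

Section rearrangement.
Variables (R : realType) (I : set R).
Hypothesis hI : I = `[0, 1]%classic \/ I = `[0, +oo[%classic.

Lemma measurable_domain : measurable (I : set (lebesgueType R)).
Proof. by case: hI => ->; exact: measurable_interval. Qed.

Lemma measurable_superlevel f (s : R) : L0 I f ->
  measurable ([set x | I x /\ s < `|f x|] : set (lebesgueType R)).
Proof.
move=> mf.
have mnf : measurable_fun (I : set (lebesgueType R))
    ((fun x => `|f x|) : lebesgueType R -> R).
  exact: (measurableT_comp (@normr_measurable R setT) mf).
have := mnf measurable_domain `]s, +oo[%classic (measurable_itv _).
congr (measurable _); apply/seteqP; split => x /=;
  by rewrite in_itv/= andbT.
Qed.

Lemma measurable_initial_segment (e : \bar R) :
  measurable ([set x | [/\ I x, 0 < x & (x%:E < e)%E]] : set (lebesgueType R)).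
Proof.
case: e => [r| |].
- have -> : [set x | [/\ I x, 0 < x & (x%:E < r%:E)%E]] = I `&` `]0, r[%classic.
    apply/seteqP; split => x /=; rewrite in_itv/= lte_fin.
      by case=> Ix -> ->.
    by case=> Ix /andP[-> ->].
  exact: (measurableI _ _ measurable_domain (measurable_interval _)).
- have -> : [set x | [/\ I x, 0 < x & (x%:E < +oo)%E]] = I `&` `]0, +oo[%classic.
    apply/seteqP; split => x /=; rewrite in_itv/= andbT ltry.
      by case.
    by case.
  exact: (measurableI _ _ measurable_domain (measurable_interval _)).
- rewrite (_ : mkset _ = set0) ?measurable0//.
  by apply/seteqP; split => x //= [_ _]; rewrite ltNge leNye.
Qed.

Lemma leb_initial_segment (e : \bar R) : (0 <= e)%E -> (e <= leb I)%E ->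
  leb [set x | [/\ I x, 0 < x & (x%:E < e)%E]] = e.
Proof.
case: e => [r| |] //; last first.
  case: hI => -> _; rewrite leb_itv/=.
    by rewrite lte_fin ltr01 oppr0 adde0 leye_eq.
  move=> _; rewrite (_ : mkset _ = `]0, +oo[%classic) ?leb_itv//=.
    by rewrite ltry oppr0 adde0.
  apply/seteqP; split => x /=; rewrite !in_itv/= !andbT ltry.
    by case.
  by move=> x0; rewrite ltW.
rewrite lee_fin => r0 rI.
rewrite (_ : mkset _ = `]0, r[%classic) ?leb_itv//=.
  rewrite lte_fin oppr0 adde0; case: ltP => // r0'.
  by congr (_%:E); apply/eqP; rewrite eq_le r0 r0'.
apply/seteqP; split => x /=; rewrite !in_itv/= !lte_fin.
  by case=> _ -> ->.
move=> /andP[x0 xr]; split => //.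
move: rI; case: hI => ->; rewrite leb_itv/= in_itv/= (ltW x0)//=.
by rewrite lte_fin ltr01 oppr0 adde0 lee_fin => r1; rewrite (le_trans (ltW xr)).
Qed.

Lemma distr_ge0 f s : (0 <= distr I f s)%E.
Proof. exact: measure_ge0. Qed.

Lemma distr_leI f s : L0 I f -> (distr I f s <= leb I)%E.
Proof.
move=> mf; apply: le_measure; rewrite ?inE.
- exact: measurable_superlevel.
- exact: measurable_domain.
- by move=> x [].
Qed.

Lemma distr_nonincreasing f s s' : L0 I f -> s <= s' ->
  (distr I f s' <= distr I f s)%E.
Proof.
move=> mf ss'; apply: le_measure; rewrite ?inE.
- exact: measurable_superlevel.
- exact: measurable_superlevel.
- by move=> x [Ix] /(le_lt_trans ss').
Qed.

(** Right continuity of the distribution function, in the form that makes the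
    superlevel sets of the rearrangement open intervals: the sets
    [|f| > s + 1 / n] increase to [|f| > s]. *)
Lemma distr_right_continuous f s (e : \bar R) : L0 I f -> (e < distr I f s)%E ->
  exists2 s', s < s' & (e < distr I f s')%E.
Proof.
move=> mf; rewrite ltNge => /negP eds; apply: contrapT => nex; apply: eds.
pose F (n : nat) : set (lebesgueType R) :=
  [set x | I x /\ s + n.+1%:R^-1 < `|f x|].
have Fs : \bigcup_n F n = [set x | I x /\ s < `|f x|].
  apply/seteqP; split => x /=.
    by move=> [n _ [Ix]] /(lt_trans _) -> //; rewrite ltrDl invr_gt0.
  move=> [Ix sf]; have /ltr_add_invr[n sn] := sf.
  by exists n.
rewrite /distr -Fs.
have mF n : measurable (F n) by exact: measurable_superlevel.
have ndF : {homo F : n m / (n <= m)%N >-> (n <= m)%O}.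
  move=> n m nm; apply/subsetPset => x [Ix] /(le_lt_trans _) H; split => //.
  by apply: H; rewrite lerD2l lef_pV2 ?posrE// ler_nat ltnS.
have cF := @nondecreasing_cvg_mu _ _ _ (@completed_lebesgue_measure R) F mF
  (bigcupT_measurable _ mF) ndF.
rewrite -(cvg_lim _ cF)//; apply: lime_le.
  by apply/cvg_ex; exists (leb (\bigcup_n F n)).
apply: nearW => n; rewrite leNgt; apply/negP => eFn; apply: nex.
by exists (s + n.+1%:R^-1) => //; rewrite ltrDl invr_gt0.
Qed.

(** The condition under which the supremum defining the rearrangement is finite
    at every [t > 0]. *)
Definition distr_vanishes f := forall t : R, 0 < t ->
  exists s, (distr I f s <= t%:E)%E.

(** The rearrangement is the generalized inverse of the distribution function;
    its measurability, its monotonicity and its distribution all come from this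
    Galois connection. *)
Lemma lt_rearrangement f s t : L0 I f -> distr_vanishes f -> 0 <= s ->
  s < rearrangement I f t <-> 0 < t /\ (t%:E < distr I f s)%E.
Proof.
move=> mf vf s0; rewrite /rearrangement.
case: ifPn => [t0|_]; last by split => [|[]//]; rewrite ltNge s0.
set S := (X in sup X); split => [sS|[_ td]].
  split => //.
  have S0 : S !=set0.
    apply/set0P/eqP => S0; move: sS; rewrite S0 sup0 ltNge s0//.
  have [u [u0 tu] su] := sup_gt S0 sS.
  by rewrite (lt_le_trans tu)// distr_nonincreasing// ltW.
have [s' ss' td'] := distr_right_continuous mf td.
rewrite (lt_le_trans ss')//; apply: ub_le_sup.
  have [u du] := vf _ t0; exists u => v [v0 tv].
  rewrite leNgt; apply/negP => uv.
  have := lt_le_trans tv (le_trans (distr_nonincreasing mf (ltW uv)) du).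
  by rewrite ltxx.
by split => //; rewrite (le_trans s0)// ltW.
Qed.

Lemma rearrangement_ge0 f t : 0 <= rearrangement I f t.
Proof.
rewrite /rearrangement; case: ifPn => // t0; set S := (X in sup X).
have [hS|hS] := pselect (has_sup S); last by rewrite sup_out.
have [[u Su] bS] := hS.
by rewrite (le_trans _ (ub_le_sup bS Su))//; case: Su.
Qed.

Lemma rearrangement_superlevel f s : L0 I f -> distr_vanishes f -> 0 <= s ->
  [set x | I x /\ s < rearrangement I f x] =
  [set x | [/\ I x, 0 < x & (x%:E < distr I f s)%E]].
Proof.
move=> mf vf s0; apply/seteqP; split => x /=.
  by case=> Ix /lt_rearrangement => /(_ mf vf s0)[x0 xd].
by case=> Ix x0 xd; split => //; apply/lt_rearrangement.
Qed.

Lemma L0_rearrangement f : L0 I f -> distr_vanishes f ->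
  L0 I (rearrangement I f).
Proof.
move=> mf vf; apply: measurable_superlevelP; first exact: measurable_domain.
move=> r; have [r0|r0] := leP 0 r.
  rewrite rearrangement_superlevel//; exact: measurable_initial_segment.
rewrite (_ : mkset _ = I); first exact: measurable_domain.
apply/seteqP; split => x /=; first by case.
by move=> Ix; split => //; rewrite (lt_le_trans r0)// rearrangement_ge0.
Qed.

Lemma equimeasurable_rearrangement f : L0 I f -> distr_vanishes f ->
  equimeasurable I f (rearrangement I f).
Proof.
move=> mf vf s s0.
have -> : [set x | I x /\ s < `|rearrangement I f x|] =
          [set x | I x /\ s < rearrangement I f x].
  by apply/seteqP; split => x /=; rewrite ger0_norm ?rearrangement_ge0.
rewrite rearrangement_superlevel ?ltW//.
by rewrite leb_initial_segment ?distr_ge0 ?distr_leI.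
Qed.

Lemma rearrangement_nonincreasing f x y : L0 I f -> distr_vanishes f ->
  0 < x -> x <= y -> rearrangement I f y <= rearrangement I f x.
Proof.
move=> mf vf x0 xy; rewrite leNgt; apply/negP => h.
have := rearrangement_ge0 f x => /(lt_rearrangement y mf vf).
move=> /iffLR/(_ h)[y0 yd].
have : rearrangement I f x < rearrangement I f x.
  apply/lt_rearrangement => //; first exact: rearrangement_ge0.
  by split => //; rewrite (le_lt_trans _ yd)// lee_fin.
by rewrite ltxx.
Qed.

End rearrangement.

(** * Symmetric spaces are invariant under decreasing rearrangement *)

Section symmetric.
Variables (R : realType) (I : set R).
Hypothesis hI : I = `[0, 1]%classic \/ I = `[0, +oo[%classic.

Lemma I_downward_closed x y : I y -> 0 <= x -> x <= y -> I x.
Proof.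
case: hI => -> /=; rewrite !in_itv/=; last by move=> _ ->.
by move=> /andP[_ y1] -> xy; rewrite (le_trans xy).
Qed.

Lemma I_gt0 x : I x -> x != 0 -> 0 < x.
Proof.
by case: hI => ->; rewrite /= in_itv/= => /andP[x0 _] xn0; rewrite lt_neqAle eq_sym xn0.
Qed.

Lemma ae_on_gt0 : ae_on I (fun x => 0 < x).
Proof.
exists `[0, 0]%classic; split; first exact: measurable_interval.
  by rewrite leb_itv/= ltxx.
move=> x /= /not_implyP[Ix /negP x0]; rewrite in_itv/=.
by apply: contraNT x0; rewrite -eq_le eq_sym; exact: I_gt0.
Qed.

Lemma L0_scaled_indicator (c : R) (A : set R) :
  measurable (A : set (lebesgueType R)) -> L0 I (fun x => c * \1_A x).
Proof.
by move=> mA; apply: measurable_funM => //; exact: measurable_indic.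
Qed.

Lemma equimeasurable_scaled_indicator (c : R) (A B : set R) : 0 <= c ->
  A `<=` I -> B `<=` I -> leb A = leb B ->
  equimeasurable I (fun x => c * \1_A x) (fun x => c * \1_B x).
Proof.
move=> c0 AI BI AB s s0.
have superlevel (D : set R) : D `<=` I ->
    [set x | I x /\ s < `|c * \1_D x|] = if s < c then D else set0.
  move=> DI; apply/seteqP; split => x /=.
    rewrite indicE normrM (ger0_norm c0); case: (boolP (x \in D)) => [/set_mem Dx|_].
      by rewrite normr1 mulr1 => -[_ ->].
    by rewrite normr0 mulr0 => -[_]; rewrite ltNge ltW.
  case: ifPn => // sc Dx; split; first exact: DI.
  by rewrite indicE mem_set// mulr1 ger0_norm.
by rewrite !superlevel//; case: ifPn.
Qed.

Variable X : fspace R.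
Hypothesis hX : symmetric_space I X.

(** Move the set [|f| > n] to an initial segment of the same measure: if that
    measure exceeds [t] for all [n], then [n * ||\1_]0, t[|| <= ||f||] for all
    [n], which is absurd as [\1_]0, t[] has nonzero norm. *)
Lemma symmetric_distr_vanishes f : fs_mem X f -> distr_vanishes I f.
Proof.
move=> Xf t t0; apply: contrapT => nex.
have td s : (t%:E < distr I f s)%E.
  by rewrite ltNge; apply/negP => h; apply: nex; exists s.
have bX := sym_bfs hX.
have mf : L0 I f := bfs_sub bX Xf.
pose A n := [set x | I x /\ n%:R < `|f x|].
pose E n := [set x | [/\ I x, 0 < x & (x%:E < distr I f n%:R)%E]].
pose U := `]0, t[%classic : set R.
have mA n : measurable (A n : set (lebesgueType R)).
  exact: measurable_superlevel.
have mE n : measurable (E n : set (lebesgueType R)).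
  exact: measurable_initial_segment.
have key n : fs_mem X (fun x => n%:R * \1_U x) /\
    fs_norm X (fun x => n%:R * \1_U x) <= fs_norm X f.
  have [XA NA] : fs_mem X (fun x => n%:R * \1_(A n) x) /\
      fs_norm X (fun x => n%:R * \1_(A n) x) <= fs_norm X f.
    apply: (bfs_ideal bX _ Xf); first exact: L0_scaled_indicator.
    apply: aeW => x Ix; rewrite indicE.
    case: (boolP (x \in A n)) => [/set_mem[_ nf]|_].
      by rewrite mulr1 normr_nat ltW.
    by rewrite mulr0 normr0.
  have [XE NE] : fs_mem X (fun x => n%:R * \1_(E n) x) /\
      fs_norm X (fun x => n%:R * \1_(A n) x) =
      fs_norm X (fun x => n%:R * \1_(E n) x).
    apply: (sym_equi hX) => //; try exact: L0_scaled_indicator.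
    apply: equimeasurable_scaled_indicator => //.
    - by move=> x [].
    - by move=> x [].
    - by rewrite leb_initial_segment ?distr_ge0 ?distr_leI.
  rewrite NE in NA.
  have [XU NU] : fs_mem X (fun x => n%:R * \1_U x) /\
      fs_norm X (fun x => n%:R * \1_U x) <=
      fs_norm X (fun x => n%:R * \1_(E n) x).
    apply: (bfs_ideal bX _ XE).
      by apply: L0_scaled_indicator; exact: measurable_interval.
    apply: aeW => x Ix; rewrite !normrM ler_wpM2l// !indicE.
    case: (boolP (x \in U)) => [/set_mem|_]; last by rewrite normr0.
    rewrite /U/= in_itv/= => /andP[x0 xt].
    rewrite mem_set//; split => //.
    by rewrite (lt_trans _ (td n%:R))// lte_fin.
  by split => //; rewrite (le_trans NU).
have one_mul : (fun x => 1%:R * \1_U x) = \1_U :> (R -> R).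
  by apply/funext => x; rewrite mul1r.
have [] := key 1%N; rewrite one_mul => XU _.
have NU0 : fs_norm X \1_U = 0.
  apply/eqP; rewrite eq_le (bfs_norm_ge0 bX XU) andbT leNgt; apply/negP => NU.
  have := archi_boundP (divr_ge0 (bfs_norm_ge0 bX Xf) (ltW NU)).
  rewrite ltr_pdivrMr// => /lt_le_trans; set n := Num.bound _.
  have [_] := key n; rewrite (bfs_normZ bX)// normr_nat.
  by move=> nU /(_ _ nU); rewrite ltxx.
have [N [mN N0 UN]] := bfs_norm_eq0 bX XU NU0.
have : leb U = 0%E.
  apply: measure_negligible; first exact: measurable_interval.
  exists N; split => // x Ux; apply: UN => /= h.
  have Ix : I x.
    have := lt_le_trans (td 0) (distr_leI hI 0 mf).
    move: Ux; rewrite /U/= in_itv/= => /andP[x0 xt].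
    case: hI => ->; rewrite leb_itv/= ?in_itv/= (ltW x0)//=.
    by rewrite lte_fin ltr01 oppr0 adde0 lte_fin => /(lt_trans xt)/ltW.
  by have /eqP := h Ix; rewrite indicE mem_set// oner_eq0.
rewrite /U leb_itv/= lte_fin t0 oppr0 adde0 => /eqP.
by rewrite eqe gt_eqF.
Qed.

Lemma symmetric_rearrangement f : fs_mem X f ->
  fs_mem X (rearrangement I f) /\ fs_norm X f = fs_norm X (rearrangement I f).
Proof.
move=> Xf; have vf := symmetric_distr_vanishes Xf.
have mf : L0 I f := bfs_sub (sym_bfs hX) Xf.
apply: (sym_equi hX) => //; first exact: L0_rearrangement.
exact: equimeasurable_rearrangement.
Qed.

End symmetric.

(** * Lower bounds for the Cesaro and Copson operators *)

Section operators.
Variables (R : realType) (I : set R).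
Hypothesis hI : I = `[0, 1]%classic \/ I = `[0, +oo[%classic.

Lemma L0_EFin (D : set R) f : measurable (D : set (lebesgueType R)) ->
  D `<=` I -> L0 I f ->
  measurable_fun (D : set (lebesgueType R))
    ((fun x => (f x)%:E) : lebesgueType R -> \bar R).
Proof.
move=> mD DI mf; apply/measurable_EFinP.
exact: (measurable_funS (measurable_domain hI) DI mf).
Qed.

Lemma itv0_sub_domain x : I x -> `[0, x]%classic `<=` I.
Proof.
by move=> Ix y; rewrite /= in_itv/= => /andP[]; exact: I_downward_closed.
Qed.

(** A lower bound [c] on the part [(0, a]] of [(0, x]] survives averaging over
    [(0, x]] up to the proportion [a / x]. Both the Cesaro bound ([a = x]) and
    the Cesaro-Copson bound ([a = x / 2]) are instances; in the latter the lower
    bound is known only almost everywhere. *)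
Lemma le_cesaro (g : R -> R) (c a x : R) : I x -> 0 < x -> 0 <= a -> a <= x ->
  L0 I g -> (forall s, 0 <= g s) -> 0 <= c ->
  ae_on I (fun s => 0 < s -> s <= a -> c <= g s) ->
  ((c * a / x)%:E <= cesaro_op g x)%E.
Proof.
move=> Ix x0 a0 ax mg g0 c0 cg; rewrite /cesaro_op mulrC EFinM.
apply: lee_wpmul2l; first by rewrite lee_fin invr_ge0 ltW.
have mA := @measurable_interval R `[0, a].
have mB := @measurable_interval R `[0, x].
have AB : `[0, a]%classic `<=` `[0, x]%classic.
  by move=> s; rewrite /= !in_itv/= => /andP[-> /le_trans ->].
have BI : `[0, x]%classic `<=` I := itv0_sub_domain Ix.
have cgA : ae_on `[0, a]%classic (fun s => c <= g s).
  apply: (ae_on_sub (subset_trans AB BI) (ae_on_and cg (ae_on_gt0 hI))).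
  by move=> s; rewrite /= in_itv/= => /andP[_ sa] [cgs s0]; exact: cgs.
have le1 : (\int[@completed_lebesgue_measure R]_(s in `[0%R, a]) c%:E <=
    \int[@completed_lebesgue_measure R]_(s in `[0%R, a]) (g s)%:E)%E.
  apply: (ae_ge0_le_integral mA) => //.
  - by move=> s _; rewrite lee_fin.
  - exact: (L0_EFin mA (subset_trans AB BI) mg).
have g0' s : `[0, x]%classic s -> (0 <= (g s)%:E)%E by rewrite lee_fin.
have le2 := ge0_subset_integral (@completed_lebesgue_measure R) mA mB
  (L0_EFin mB BI mg) g0' AB.
apply: le_trans le2; apply: le_trans le1.
rewrite (integral_cst _ mA) EFinM.
suff <- : leb `[0, a]%classic = a%:E by [].
rewrite leb_itv/= lte_fin oppr0 adde0; case: ltP => // a0'.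
by congr (_%:E); apply/eqP; rewrite eq_le a0 a0'.
Qed.

(** On [[a, +oo[] the function [1 / t] agrees with [1 / max a t], which is
    nonincreasing on the whole line and hence measurable. *)
Lemma measurable_div_id (g : R -> R) (a : R) : 0 < a -> L0 I g ->
  L0 (I `&` `[a, +oo[%classic) (fun t => g t / t).
Proof.
move=> a0 mg.
have mB : measurable (I `&` `[a, +oo[%classic : set (lebesgueType R)).
  exact: (measurableI _ _ (measurable_domain hI) (measurable_interval _)).
apply: measurable_funM.
  by apply: (measurable_funS (measurable_domain hI) _ mg) => s [].
have mi : measurable_fun setT (fun t : R => (Num.max a t)^-1).
  apply: nonincreasing_measurable => // s t st.
  rewrite lef_pV2 ?posrE ?lt_max ?a0//.
  by rewrite ge_max le_max lexx/= le_max st orbT.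
apply: measurable_superlevelP => // r.
rewrite (_ : mkset _ =
    (I `&` `[a, +oo[%classic) `&` [set t | r < (Num.max a t)^-1]).
  apply: (measurableI _ _ mB); apply: sub_caratheodory.
  have := mi measurableT _ (measurable_itv `]r, +oo[).
  rewrite setTI; congr (measurable _); apply/seteqP; split => t /=;
    by rewrite in_itv/= andbT.
by apply/seteqP; split => t /=; rewrite in_itv/= andbT => -[[It ta]];
  rewrite (max_idPr ta).
Qed.

(** Restricting the integral of [g t / t] to [[x / 2, x]] already gives [g x / 2],
    for there [g t / t >= g x / x]. *)
Lemma le_copson (g : R -> R) (a x : R) : I x -> 0 < a -> a <= x / 2 ->
  L0 I g -> (forall s, 0 <= g s) ->
  (forall s, 0 < s -> s <= x -> g x <= g s) ->
  ((g x / 2)%:E <= copson_op I g a)%E.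
Proof.
move=> Ix a0 ax mg g0 gx; rewrite /copson_op.
have x20 : 0 < x / 2 by exact: lt_le_trans ax.
have x2x : x / 2 < x by lra.
have x0 : 0 < x by exact: lt_trans x2x.
have mB : measurable (I `&` `[a, +oo[%classic : set (lebesgueType R)).
  exact: (measurableI _ _ (measurable_domain hI) (measurable_interval _)).
have mA := @measurable_interval R `[x / 2, x].
have AB : `[x / 2, x]%classic `<=` I `&` `[a, +oo[%classic.
  move=> s; rewrite /= !in_itv/= andbT => /andP[xs sx].
  split; last by rewrite (le_trans ax).
  by apply: (I_downward_closed hI Ix) => //; rewrite (le_trans _ xs)// ltW.
have mq : measurable_fun (I `&` `[a, +oo[%classic : set (lebesgueType R))
    ((fun t => (g t / t)%:E) : lebesgueType R -> \bar R).
  by apply/measurable_EFinP; exact: measurable_div_id.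
have q0 t : (I `&` `[a, +oo[%classic) t -> (0 <= (g t / t)%:E)%E.
  move=> [_ /=]; rewrite in_itv/= andbT => sa.
  by rewrite lee_fin divr_ge0// (le_trans _ sa)// ltW.
have le2 := ge0_subset_integral (@completed_lebesgue_measure R) mA mB mq q0 AB.
apply: le_trans le2.
have le1 : (\int[@completed_lebesgue_measure R]_(s in `[(x / 2)%R, x]) (g x / x)%:E <=
    \int[@completed_lebesgue_measure R]_(s in `[(x / 2)%R, x]) (g s / s)%:E)%E.
  apply: (ge0_le_integral _ mA).
  - by move=> s _; rewrite lee_fin divr_ge0// ltW.
  - by [].
  - exact: (measurable_funS mB AB mq).
  - move=> s; rewrite /= in_itv/= => /andP[xs sx]; rewrite lee_fin.
    have s0 : 0 < s by exact: lt_le_trans xs.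
    by rewrite ler_pM ?invr_ge0 ?(ltW x0) ?gx// lef_pV2 ?posrE.
apply: le_trans le1.
rewrite (integral_cst _ mA).
have -> : (g x / 2)%:E = ((g x / x)%:E * (x / 2)%:E)%E.
  by rewrite -EFinM mulrA mulfVK// gt_eqF.
suff <- : leb `[x / 2, x]%classic = (x / 2)%:E by [].
by rewrite leb_itv/= lte_fin x2x -EFinB {1}[x]splitr addrK.
Qed.

(** By [le_copson] the Copson transform is at least [g x / 2] on [(0, x / 2]],
    which is half of [(0, x]]; this is where [4] comes from. The function [h]
    stands for the finite part of the Copson transform, which may differ from it
    on a null set. *)
Lemma le_cesaro_copson (g h : R -> R) (x : R) : I x -> 0 < x ->
  L0 I g -> (forall s, 0 <= g s) ->
  (forall s, 0 < s -> s <= x -> g x <= g s) ->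
  L0 I h -> (forall s, 0 <= h s) ->
  ae_on I (fun s => (copson_op I g s <= (h s)%:E)%E) ->
  ((g x / 4)%:E <= cesaro_op h x)%E.
Proof.
move=> Ix x0 mg g0 gx mh h0 gh.
have x20 : 0 < x / 2 by rewrite divr_gt0.
have -> : g x / 4 = (g x / 2) * (x / 2) / x.
  have xn0 : x != 0 by rewrite gt_eqF.
  by field.
apply: (le_cesaro Ix x0 (ltW x20) _ mh h0).
- by rewrite ler_pdivrMr// ler_pMr// ler1n.
- by rewrite divr_ge0.
- apply: (ae_on_sub _ gh) => // s Is gs s0 sx.
  by rewrite -lee_fin; apply: le_trans gs; exact: le_copson.
Qed.

Lemma cesaro_ge_nonincreasing (g : R -> R) (x : R) : I x -> 0 < x ->
  L0 I g -> (forall s, 0 <= g s) ->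
  (forall s, 0 < s -> s <= x -> g x <= g s) ->
  ((g x)%:E <= cesaro_op g x)%E.
Proof.
move=> Ix x0 mg g0 gx.
have -> : g x = g x * x / x by rewrite mulfK// gt_eqF.
apply: (le_cesaro Ix x0 (ltW x0) (lexx x) mg g0 (g0 x)).
by apply: aeW => s Is; exact: gx.
Qed.

End operators.

Lemma ideal_of_le_fine (R : realType) (I : set R) (Y : fspace R)
  (g : R -> R) (u : R -> \bar R) (c : R) :
  banach_function_space I Y -> L0 I g -> 0 <= c -> (forall x, 0 <= g x) ->
  emem I Y u -> ae_on I (fun x => ((g x)%:E <= c%:E * u x)%E) ->
  fs_mem Y g /\ fs_norm Y g <= c * fs_norm Y (fine \o u).
Proof.
move=> bY mg c0 g0 [ufin Yu] gu.
have [] := bfs_ideal bY mg (bfs_scale bY c Yu).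
  apply: (ae_on_sub _ (ae_on_and ufin gu)) => // x Ix [ux].
  rewrite /= -(fineK ux) -EFinM lee_fin => gx.
  by rewrite ger0_norm// (le_trans gx)// ler_norm.
by rewrite (bfs_normZ bY)// ger0_norm.
Qed.

(** * Comparison of X with TX *)

Section comparison.
Variables (R : realType) (I : set R) (T : (R -> R) -> R -> \bar R).
Hypothesis hI : I = `[0, 1]%classic \/ I = `[0, +oo[%classic.

(** The operator [T] is bounded below on nonincreasing functions, with a
    constant that depends on [Y] only: [1] for [T = C], and [4] times a bound of
    [C] on [Y] for [T = C^*]. *)
Lemma op_space_nonincreasing (Y : fspace R) :
  banach_function_space I Y ->
  T = @cesaro_op R \/ T = copson_op I /\ bounded_on I (@cesaro_op R) Y ->
  exists c : R, forall g, (forall s, 0 <= g s) ->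
    (forall s x, 0 < s -> s <= x -> g x <= g s) ->
    fs_mem (op_space I T Y) g ->
    fs_mem Y g /\ fs_norm Y g <= c * fs_norm (op_space I T Y) g.
Proof.
move=> bY hT.
have abs_id (g : R -> R) : (forall s, 0 <= g s) -> (fun x => `|g x|) = g.
  by move=> g0; apply/funext => x; rewrite ger0_norm.
case: hT => [->|[-> [K bK]]].
  exists 1 => g g0 gni; rewrite /op_space/= abs_id// => -[mg Cg].
  apply: (ideal_of_le_fine bY mg ler01 g0 Cg).
  apply: (ae_on_sub _ (ae_on_gt0 hI)) => // x Ix x0.
  by rewrite mul1e; apply: (cesaro_ge_nonincreasing hI) => // s s0; exact: gni.
exists (4 * K) => g g0 gni; rewrite /op_space/= abs_id// => -[mg Cg].
have [Cfin YC] := Cg.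
set h := fine \o copson_op I g.
have [CCg CCn] := bK h YC.
have h0 s : 0 <= h s.
  apply: fine_ge0; apply: integral_ge0 => t [It ts].
  rewrite lee_fin divr_ge0//.
  by move: It; case: hI => ->; rewrite /= in_itv/= => /andP[].
have [Yg ng] : fs_mem Y g /\ fs_norm Y g <= 4 * fs_norm Y (fine \o cesaro_op h).
  apply: (ideal_of_le_fine bY mg _ g0 CCg) => //.
  apply: (ae_on_sub _ (ae_on_gt0 hI)) => // x Ix x0.
  have : ((g x / 4)%:E <= cesaro_op h x)%E.
    apply: (le_cesaro_copson hI) => //.
    - by move=> s s0; exact: gni.
    - exact: (bfs_sub bY).
    - apply: (ae_on_sub _ Cfin) => // s Is Cs.
      by rewrite /h/= fineK.
  move=> /(lee_wpmul2l (_ : (0 <= 4%:E :> \bar R)%E)).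
  by rewrite -EFinM mulrC mulfVK// => -> //; rewrite lee_fin.
split => //; apply: (le_trans ng).
by rewrite -mulrA ler_pM2l.
Qed.

(** For [f] in [X] with rearrangement [g], chain
    [||f||_Y = ||g||_Y <= c ||g||_TY <= c b ||g||_TX <= c b K ||g||_X] and
    [||g||_X = ||f||_X]. *)
Lemma embedding_of_op_space (X Y : fspace R) (b : R) :
  symmetric_space I X -> symmetric_space I Y -> bounded_on I T X ->
  T = @cesaro_op R \/ T = copson_op I /\ bounded_on I (@cesaro_op R) Y ->
  0 <= b ->
  (forall f, fs_mem (op_space I T X) f -> fs_mem (op_space I T Y) f /\
    fs_norm (op_space I T Y) f <= b * fs_norm (op_space I T X) f) ->
  exists2 c : R, 0 < c &
    forall f, fs_mem X f -> fs_mem Y f /\ fs_norm Y f <= c * fs_norm X f.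
Proof.
move=> sX sY [K bK] hT b0 XY.
have [c hc] := op_space_nonincreasing (sym_bfs sY) hT.
(* [c] and [K] may be negative a priori; adding [1] makes the constant
   positive even if they vanish. *)
exists (`|c| * (b * `|K|) + 1) => [|f Xf].
  by rewrite ltr_wpDl// !mulr_ge0.
have [Xr nr] := symmetric_rearrangement hI sX Xf.
have mf : L0 I f := bfs_sub (sym_bfs sX) Xf.
have vf := symmetric_distr_vanishes hI sX Xf.
set g := rearrangement I f in Xr nr.
have g0 s : 0 <= g s by exact: rearrangement_ge0.
have mg : L0 I g := bfs_sub (sym_bfs sX) Xr.
have [TXg nTg] := bK g Xr.
have absg : (fun x => `|g x|) = g.
  by apply/funext => x; rewrite ger0_norm.
have TXg' : fs_mem (op_space I T X) g by rewrite /= absg.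
have [TYg nYg] := XY _ TXg'.
have gni s x : 0 < s -> s <= x -> g x <= g s.
  by move=> s0 sx; exact: (rearrangement_nonincreasing hI mf vf).
have [Yg ng] := hc g g0 gni TYg.
have [Yf nf] : fs_mem Y f /\ fs_norm Y g = fs_norm Y f.
  apply: (sym_equi sY) => // s s0.
  by rewrite (equimeasurable_rearrangement hI mf vf s0).
split => //; rewrite -nf nr (le_trans ng)//.
have nX := bfs_norm_ge0 (sym_bfs sX) Xr.
rewrite mulrDl mul1r ler_wpDr//.
have nT0 : 0 <= fs_norm (op_space I T Y) g by exact: (bfs_norm_ge0 (sym_bfs sY) TYg.2.2).
rewrite (le_trans (ler_wpM2r nT0 (ler_norm c)))// -mulrA ler_wpM2l//.
rewrite (le_trans nYg)// -mulrA ler_wpM2l//= absg (le_trans nTg)//.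
by rewrite ler_wpM2r// ler_norm.
Qed.

Lemma space_eq_op_space (X Y : fspace R) :
  space_eq X Y -> space_eq (op_space I T X) (op_space I T Y).
Proof.
move=> [XY [a [b [a0 b0 ab]]]]; split; first by rewrite /op_space/emem XY.
by exists a, b; split => // f [_ [_ Xf]]; exact: ab.
Qed.

End comparison.

Lemma space_eq_of_embeddings (R : realType) (X Y : fspace R) (b c : R) :
  0 < b -> 0 < c ->
  (forall f, fs_mem X f -> fs_mem Y f /\ fs_norm Y f <= b * fs_norm X f) ->
  (forall f, fs_mem Y f -> fs_mem X f /\ fs_norm X f <= c * fs_norm Y f) ->
  space_eq X Y.
Proof.
move=> b0 c0 XY YX; split.
  by apply/seteqP; split => f; [case/XY|case/YX].
exists c^-1, b; split => //; first by rewrite invr_gt0.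
move=> f Xf; have [Yf nY] := XY f Xf; have [_ nX] := YX f Yf.
by rewrite mulrC ler_pdivrMr// [fs_norm Y f * _]mulrC.
Qed.

Unset Implicit Arguments.
Set Strict Implicit.

Theorem lemma6p3 (R : realType) (I : set R) (T : (R -> R) -> R -> \bar R)
    (X Y : fspace R)
    (hI : I = `[0, 1]%classic \/ I = `[0, +oo[%classic)
    (hT : T = @cesaro_op R \/ T = copson_op I)
    (hX : symmetric_space I X) (hY : symmetric_space I Y)
    (hi : T = @cesaro_op R ->
      bounded_on I (@cesaro_op R) X /\ bounded_on I (@cesaro_op R) Y)
    (hii : T = copson_op I ->
      [/\ bounded_on I (@cesaro_op R) X, bounded_on I (copson_op I) X,
          bounded_on I (@cesaro_op R) Y & bounded_on I (copson_op I) Y]) :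
  space_eq X Y <-> space_eq (op_space I T X) (op_space I T Y).
Proof.
split; first exact: space_eq_op_space.
move=> [TXY [a [b [a0 b0 ab]]]].
have [TX TY hTX hTY] : [/\ bounded_on I T X, bounded_on I T Y,
    T = @cesaro_op R \/ T = copson_op I /\ bounded_on I (@cesaro_op R) X &
    T = @cesaro_op R \/ T = copson_op I /\ bounded_on I (@cesaro_op R) Y].
  case: hT => e.
    by have [CX CY] := hi e; rewrite {1 2}e; split => //; left.
  by have [CX DX CY DY] := hii e; rewrite {1 2}e; split => //; right.
have [f|d d0 XY] := embedding_of_op_space hI hX hY TX hTY (ltW b0).
  by move=> Xf; rewrite -TXY; split => //; case: (ab f Xf).
have [||d' d'0 YX] := @embedding_of_op_space _ _ _ hI _ _ a^-1 hY hX TY hTX.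
- by rewrite invr_ge0 ltW.
- move=> f; rewrite -TXY => Xf; split => //.
  by rewrite ler_pdivlMl//; case: (ab f Xf).
exact: space_eq_of_embeddings XY YX.
Qed.
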